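(* Let $n\ge 3$ be an integer and let $L(K_n)$ be the line graph of the complete graph $K_n$ on $n$ vertices. Then \[ \mathrm{gp}(L(K_n))=\begin{cases} n, & 3\mid n,\\ n-1, & 3\nmid n. \end{cases} \]
   Context: Graphs are finite, undirected and simple. The line graph $L(G)$ of a graph $G$ has vertex set $E(G)$, two different vertices of $L(G)$ being adjacent if the corresponding edges share a vertex in $G$. For a graph $G$, $d_G$ is the shortest-path distance; a $u,v$-geodesic is a $u,v$-path of length $d_G(u,v)$. A set $S\subseteq V(G)$ is a general position set of $G$ if no vertex of $S$ lies on a geodesic between two other vertices of $S$. The general position number $\mathrm{gp}(G)$ is the maximum cardinality of a general position set of $G$. *)

(* Defs.v *)
From mathcomp Require Import all_boot.

Set Implicit Arguments.
Unset Strict Implicit.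
Unset Printing Implicit Defensive.

Record sgraph := SGraph {
  svertex :> finType;
  sedge : rel svertex;
  sedge_sym : symmetric sedge;
  sedge_irrefl : irreflexive sedge
}.

Section Metric.
Variable G : sgraph.
Implicit Types (u v w : G) (p : seq G) (S : {set G}).

(* As in path.v, the path has vertices u :: p, hence length size p. *)
Definition is_path u v p : bool :=
  [&& path (@sedge G) u p, last u p == v & uniq (u :: p)].

(* Least length of a u,v-path. A path repeats no vertex, so its length is less
   than #|G|; #|G| is therefore the value when u and v are not connected. *)
Definition dist u v : nat :=
  find (fun k => [exists p : k.-tuple G, is_path u v p]) (iota 0 #|G|).

Definition geodesic u v p : bool := is_path u v p && (size p == dist u v).

Definition on_geodesic u v w : bool :=
  [exists p : (dist u v).-tuple G, geodesic u v p && (w \in u :: p)].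

Definition general_position S : bool :=
  [forall u in S, forall v in S, forall w in S,
     [&& u != v, w != u & w != v] ==> ~~ on_geodesic u v w].

Definition gp : nat := \max_(S : {set G} | general_position S) #|S|.

Lemma is_path_size u v p : is_path u v p -> size p < #|G|.
Proof. by case/and3P=> _ _ /card_uniqP/= <-; apply: max_card. Qed.

Lemma dist_le u v p : is_path u v p -> dist u v <= size p.
Proof.
move=> up; rewrite leqNgt; apply/negP=> /(before_find 0).
rewrite nth_iota ?(is_path_size up)// add0n => /existsP[].
by exists (in_tuple p).
Qed.

Lemma geodesic_exists u v p : is_path u v p -> exists q, geodesic u v q.
Proof.
move=> up; set a := fun k => [exists p : k.-tuple G, is_path u v p].
have lt_d : dist u v < #|G| := leq_ltn_trans (dist_le up) (is_path_size up).
have has_a : has a (iota 0 #|G|) by rewrite has_find size_iota.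
have := nth_find 0 has_a; rewrite nth_iota // add0n => /existsP[q uq].
by exists q; rewrite /geodesic uq size_tuple eqxx.
Qed.

Lemma on_geodesicP u v w :
  reflect (exists2 p, geodesic u v p & w \in u :: p) (on_geodesic u v w).
Proof.
apply: (iffP existsP) => [[p /andP[]]|[p gp_p wp]]; first by exists p.
have sz : size p == dist u v by case/andP: gp_p.
by exists (Tuple sz); rewrite gp_p.
Qed.

End Metric.

Section Complete.
Variable n : nat.

Definition complete_rel : rel 'I_n := fun x y => x != y.

Lemma complete_sym : symmetric complete_rel.
Proof. by move=> x y; rewrite /complete_rel eq_sym. Qed.

Lemma complete_irrefl : irreflexive complete_rel.
Proof. by move=> x; rewrite /complete_rel eqxx. Qed.

Definition complete_graph : sgraph := SGraph complete_sym complete_irrefl.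
End Complete.

Section LineGraph.
Variable G : sgraph.

Definition edges : {set {set G}} :=
  [set e | [exists x : G, exists y : G, sedge x y && (e == [set x; y])]].

Definition edge_type : finType := {e : {set G} | e \in edges}.

Definition line_rel : rel edge_type :=
  fun e f => (e != f) && ~~ [disjoint val e & val f].

Lemma line_sym : symmetric line_rel.
Proof. by move=> e f; rewrite /line_rel eq_sym disjoint_sym. Qed.

Lemma line_irrefl : irreflexive line_rel.
Proof. by move=> e; rewrite /line_rel eqxx. Qed.

Definition line_graph : sgraph := SGraph line_sym line_irrefl.
End LineGraph.

(* Main.v *)
(* L(K_n) has diameter at most 2, so a set of edges of K_n is in general
   position exactly when "sharing a vertex" is transitive on it, i.e. when every
   component of the subgraph it spans is a star or a triangle.  A star has fewer
   edges than vertices and a triangle as many, so there are at most n edges, with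
   equality only if disjoint triangles cover all the vertices.  A spanning star
   and, when 3 divides n, a perfect packing by triangles attain the bounds. *)
Require Import Defs.
From mathcomp Require Import all_boot zify.

Set Implicit Arguments.
Unset Strict Implicit.
Unset Printing Implicit Defensive.

(** Unlike adjacency in the line graph, this relates a nonempty set to itself, so a family of pairs
    on which it is transitive splits into equivalence classes. *)
Definition meets (V : finType) : rel {set V} := fun e f => ~~ [disjoint e & f].

(** * General position in graphs of diameter at most two *)

Section DiameterTwo.
Variable G : sgraph.
Implicit Types (u v w : G) (S : {set G}).

Lemma sedge_neq u v : sedge u v -> u != v.
Proof. by apply: contraTneq => ->; rewrite sedge_irrefl. Qed.

Lemma is_path2 u v w : sedge u w -> sedge w v -> u != v -> is_path u v [:: w; v].
Proof.
move=> uw wv uv; rewrite /is_path /= uw wv eqxx !inE negb_or uv.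
by rewrite (sedge_neq uw) (sedge_neq wv).
Qed.

Lemma geodesic_edge u v p : sedge u v -> geodesic u v p -> p = [:: v].
Proof.
move=> uv /andP[/and3P[_ /eqP pv _] /eqP sz_p].
have /dist_le : is_path u v [:: v].
  by rewrite /is_path /= uv eqxx inE (sedge_neq uv).
rewrite -sz_p; case: p pv {sz_p} => [|x [|]] //= eq_v _; last by rewrite eq_v.
by move: uv; rewrite eq_v sedge_irrefl.
Qed.

Lemma on_geodesic_nonadjacent u v w :
  sedge u w -> sedge w v -> u != v -> ~~ sedge u v -> on_geodesic u v w.
Proof.
move=> uw wv uv nuv; have uwv := is_path2 uw wv uv.
apply/on_geodesicP; exists [:: w; v]; last by rewrite !inE eqxx orbT.
rewrite /geodesic uwv eqn_leq dist_le // andbT.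
have [p /andP[/and3P[up /eqP pv _] /eqP <-]] := geodesic_exists uwv.
(* A path of length 0 or 1 would make [u] and [v] equal or adjacent. *)
case: p up pv => [|x [|y p]] //= => [_ eq_uv|/andP[ux _] eq_xv].
  by rewrite eq_uv eqxx in uv.
by rewrite -eq_xv ux in nuv.
Qed.

(** With diameter at most two, a geodesic has an inner vertex only when its ends are nonadjacent,
    and that vertex is then a common neighbour of both. *)
Lemma general_position_diameter2 S :
  (forall u v, u != v -> ~~ sedge u v -> exists2 w, sedge u w & sedge w v) ->
  reflect {in S & &, forall u w v, sedge u w -> sedge w v -> u != v -> sedge u v}
          (general_position S).
Proof.
move=> diam2; apply: (iffP idP) => [gpS u w v uS wS vS uw wv uv | trS].
  move/forall_inP: gpS => /(_ u uS) /forall_inP /(_ v vS) /forall_inP /(_ w wS).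
  rewrite uv (sedge_neq wv) eq_sym (sedge_neq uw) /=.
  by apply: contraR; apply: on_geodesic_nonadjacent.
apply/forall_inP => u uS; apply/forall_inP => v vS; apply/forall_inP => w wS.
apply/implyP => /and3P[uv wu wv]; apply/on_geodesicP => -[p gp_p w_p].
have [e_uv | ne_uv] := boolP (sedge u v).
  move: w_p; rewrite (geodesic_edge e_uv gp_p) !inE.
  by rewrite (negPf wu) (negPf wv).
have [x ux xv] := diam2 u v uv ne_uv.
have := dist_le (is_path2 ux xv uv).
case/andP: gp_p => /and3P[up /eqP pv _] /eqP <- sz_p.
case: p up pv sz_p w_p => [|y [|z [|]]] //= up pv _.
- by rewrite !inE (negPf wu).
- by rewrite -pv !inE (negPf wu) in wv *; rewrite (negPf wv).
rewrite -pv !inE (negPf wu) in wv *; rewrite (negPf wv) orbF => /eqP wy.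
(* [w] is now the middle vertex, so [trS] makes the ends adjacent, against [ne_uv]. *)
case/and3P: up => uy yz _; rewrite -wy in uy yz.
by rewrite -pv (trS u w z) // pv in ne_uv *.
Qed.

End DiameterTwo.

(** * Families of pairs on which meeting is transitive *)

Section PairFamilies.
Variable V : finType.
Implicit Types (e f g : {set V}) (x y z : V) (B T : {set {set V}}).

Lemma meetsP e f : reflect (exists2 x, x \in e & x \in f) (meets e f).
Proof.
rewrite /meets disjoint_subset; apply: (iffP subsetPn) => -[x xe].
  by rewrite inE negbK; exists x.
by exists x; rewrite // inE negbK.
Qed.

Lemma meets_sym : symmetric (@meets V).
Proof. by move=> e f; rewrite /meets disjoint_sym. Qed.

Lemma meets_refl e : #|e| = 2 -> meets e e.
Proof.
move=> e2; have /card_gt0P[x xe] : 0 < #|e| by rewrite e2.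
by apply/meetsP; exists x.
Qed.

Lemma meets_set2 x y e : meets [set x; y] e = (x \in e) || (y \in e).
Proof.
apply/meetsP/orP => [[z /set2P[]-> ze]|[ze|ze]]; [by left | by right | |].
  by exists x; rewrite // set21.
by exists y; rewrite // set22.
Qed.

Lemma pair_other e x : #|e| = 2 -> x \in e -> exists2 y, y != x & e = [set x; y].
Proof.
move/eqP/cards2P=> [a [b [ab ->]]] /set2P[]->; first by exists b; rewrite // eq_sym.
by exists a; rewrite // setUC.
Qed.

(** Every pair of [B] is [[set x; y]] for some [y] in [cover B] other than the centre [x]. *)
Lemma card_star B x :
  {in B, forall e, #|e| = 2} -> {in B, forall e, x \in e} -> B != set0 ->
  #|B| < #|cover B|.
Proof.
move=> B2 Bx /set0Pn[e0 e0B].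
have xB : x \in cover B by apply/bigcupP; exists e0; rewrite ?Bx.
rewrite (cardsD1 x (cover B)) xB ltnS.
apply: leq_trans (leq_imset_card (fun y => [set x; y]) _); apply: subset_leq_card.
apply/subsetP => e eB; have [y yx def_e] := pair_other (B2 e eB) (Bx e eB).
apply/imsetP; exists y => //; rewrite !inE yx; apply/bigcupP; exists e => //.
by rewrite def_e set22.
Qed.

(** Pairwise meeting pairs either share a common vertex, forming a star, or are the sides of one
    triangle. *)
Lemma card_intersecting B :
  {in B, forall e, #|e| = 2} -> {in B &, forall e f, meets e f} -> B != set0 ->
  #|B| < #|cover B| \/ #|B| <= 3 /\ #|cover B| = 3.
Proof.
move=> B2 Bm Bn0; have [/existsP[x /forall_inP Bx] | no_centre] :=
  boolP [exists x, [forall e in B, x \in e]].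
  by left; apply: card_star Bx Bn0.
right; have avoid x : exists2 e, e \in B & x \notin e.
  by move/existsPn: no_centre => /(_ x) /forall_inPn.
have [e eB] := set0Pn _ Bn0.
have /eqP/cards2P[a [b [ab def_e]]] := B2 e eB.
(* [f] misses [a] and [g] misses [b], but both meet [e], so [b] is in [f] and [a] in [g]; they can
   only meet in a third vertex [c]. *)
have [f fB af] := avoid a; have [g gB bg] := avoid b.
have bf : b \in f by have := Bm e f eB fB; rewrite def_e meets_set2 (negPf af).
have ag : a \in g.
  by have := Bm e g eB gB; rewrite def_e meets_set2 (negPf bg) orbF.
have [c cb def_f] := pair_other (B2 f fB) bf.
have cg : c \in g by have := Bm f g fB gB; rewrite def_f meets_set2 (negPf bg).
have ca : c != a by apply: contraNneq af => <-; rewrite def_f set22.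
have def_g : g = [set a; c].
  have [d da def_g] := pair_other (B2 g gB) ag.
  by move: cg; rewrite def_g !inE (negPf ca) /= => /eqP->.
(* A pair meeting all three sides contains two of [a], [b], [c], hence is a side. *)
have sB : B \subset [set e; f; g].
  apply/subsetP => h hB; rewrite !inE -!orbA.
  have eqh (k : {set V}) : k \subset h -> #|k| = 2 -> h == k.
    by move=> kh k2; rewrite eq_sym eqEcard kh k2 B2.
  have := Bm _ _ eB hB; have := Bm _ _ fB hB; have := Bm _ _ gB hB.
  rewrite {1}def_e {1}def_f {1}def_g !meets_set2.
  have he : a \in h -> b \in h -> h == e.
    by move=> ah bh; apply: eqh (B2 e eB); rewrite def_e subUset !sub1set ah.
  have hf : b \in h -> c \in h -> h == f.
    by move=> bh ch; apply: eqh (B2 f fB); rewrite def_f subUset !sub1set bh.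
  have hg : a \in h -> c \in h -> h == g.
    by move=> ah ch; apply: eqh (B2 g gB); rewrite def_g subUset !sub1set ah.
  move: he hf hg; case: (a \in h); case: (b \in h); case: (c \in h) => //=;
    move=> he hf hg _ _ _;
    first [by rewrite he | by rewrite hf ?orbT | by rewrite hg ?orbT].
have coverB : cover B = [set a; b; c].
  apply/setP => x; apply/bigcupP/idP => [[h /(subsetP sB)]|].
    rewrite !inE -!orbA => /or3P[]/eqP->; rewrite ?def_e ?def_f ?def_g !inE;
      by case/orP=> ->; rewrite ?orbT.
  rewrite !inE -orbA => /or3P[]/eqP->; [exists e | exists e | exists f] => //;
    by rewrite ?def_e ?def_f !inE eqxx ?orbT.
split; last first.
  by rewrite coverB -setUA cardsU1 cards2 !inE negb_or ab eq_sym ca eq_sym cb.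
apply: leq_trans (subset_leq_card sB) _.
by rewrite -setUA cardsU1 cards2; case: (_ \notin _); case: (_ != _).
Qed.

(** Meeting is an equivalence relation on [T]; distinct classes cover disjoint vertex sets, and no
    class has more pairs than it covers vertices. *)
Lemma card_transitive_pairs T :
  {in T, forall e, #|e| = 2} ->
  {in T & &, forall e f g, meets e f -> meets f g -> meets e g} ->
  #|T| <= #|V| /\ (#|T| = #|V| -> 3 %| #|V|).
Proof.
move=> T2 Tm.
have eqv : {in T & &, equivalence_rel (@meets V)}.
  move=> e f g eT fT gT; split=> [|ef]; first exact/meets_refl/T2.
  by apply/idP/idP; apply: Tm => //; rewrite meets_sym.
set P := equivalence_partition (@meets V) T.
have partP : partition P T := equivalence_partitionP eqv.
have sPT B : B \in P -> B \subset T.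
  by move=> BP; rewrite -(cover_partition partP); apply: bigcup_sup.
have meetP B C e f : B \in P -> C \in P -> e \in B -> f \in C ->
    meets e f = (B == C).
  move=> BP CP eB fC; have eT := subsetP (sPT B BP) e eB.
  have fT := subsetP (sPT C CP) f fC; have tP := partition_trivIset partP.
  rewrite -(pblock_equivalence_partition eqv eT fT) -/P.
  rewrite -eq_pblock ?(cover_partition partP) //.
  by rewrite (def_pblock tP BP eB) (def_pblock tP CP fC).
have blockP B : B \in P ->
    #|B| < #|cover B| \/ #|B| <= 3 /\ #|cover B| = 3.
  move=> BP; apply: card_intersecting => [e /(subsetP (sPT B BP))/T2 //|e f eB fB|].
    by rewrite (meetP B B) ?eqxx.
  by apply: contraTneq BP => ->; have /and3P[] := partP.
have le_block B : B \in P -> #|B| <= #|cover B|.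
  by case/blockP => [/ltnW//|[? ->]].
(* Incidences of vertices with blocks are counted: if two blocks cover [x], the pairs through [x]
   meet and the blocks coincide. *)
have le_sum : \sum_(B in P) #|cover B| <= #|V|.
  under eq_bigr => B _ do rewrite -sum1_card big_mkcond /=.
  rewrite exchange_big -sum1_card leq_sum //= => x _; rewrite -big_mkcondr sum1_card.
  apply/card_le1_eqP => C B /andP[CP /bigcupP[f fC xf]] /andP[BP /bigcupP[e eB xe]].
  by apply/eqP; rewrite -(meetP B C e f) //; apply/meetsP; exists x.
have le_T : #|T| <= \sum_(B in P) #|cover B|.
  by rewrite (card_partition partP) leq_sum.
split=> [|eq_T]; first exact: leq_trans le_sum.
have/eqP eq_sum : \sum_(B in P) #|cover B| == #|V|.
  by rewrite eqn_leq le_sum -eq_T.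
(* Equality rules out the strict bound for every block, so each covers exactly 3 vertices. *)
rewrite -eq_sum; apply: dvdn_sum => B BP.
case: (blockP B BP) => [lt_B | [_ ->] //].
have: #|T| < \sum_(B in P) #|cover B|.
  rewrite (card_partition partP) (bigD1 B) // [ltnRHS](bigD1 B) //= -addSn.
  by rewrite leq_add // leq_sum // => C /andP[/le_block].
by rewrite eq_sum eq_T ltnn.
Qed.

End PairFamilies.

(** * The line graph of a complete graph *)

Section LineComplete.
Variable n : nat.
Local Notation LK := (line_graph (complete_graph n)).

Lemma edges_completeE (e : {set 'I_n}) :
  (e \in edges (complete_graph n)) = (#|e| == 2).
Proof.
rewrite inE; apply/existsP/cards2P => [[x /existsP[y /andP[xy /eqP->]]]|].
  by exists x, y.
by case=> x [y [xy ->]]; exists x; apply/existsP; exists y; rewrite eqxx andbT.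
Qed.

Lemma card_edge (e : LK) : #|val e| = 2.
Proof. by apply/eqP; rewrite -edges_completeE (valP e). Qed.

(** Disjoint edges are both met by an edge joining an end of one to an end of the other. *)
Lemma line_complete_diameter2 (u v : LK) :
  u != v -> ~~ sedge u v -> exists2 w, sedge u w & sedge w v.
Proof.
move=> uv; rewrite /= /line_rel uv /= negbK => dis_uv.
have /eqP/cards2P[a [b [_ def_u]]] := card_edge u.
have /eqP/cards2P[c [d [_ def_v]]] := card_edge v.
have au : a \in val u by rewrite def_u set21.
have cv : c \in val v by rewrite def_v set21.
have av : a \notin val v by rewrite (disjointFr dis_uv au).
have cu : c \notin val u by rewrite (disjointFl dis_uv cv).
have ac : a != c by apply: contraNneq av => ->.
have wE : [set a; c] \in edges (complete_graph n).
  by rewrite edges_completeE cards2 ac.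
exists (Sub [set a; c] wE); rewrite /line_rel -!/(meets _ _) SubK.
  rewrite meets_sym meets_set2 au andbT; apply: contraNneq cu => ->.
  by rewrite SubK set22.
rewrite meets_set2 cv orbT andbT; apply: contraNneq av => <-.
by rewrite SubK set21.
Qed.

(** Passing from adjacency to [meets] is harmless: when two of the three edges coincide, the
    conclusion is immediate. *)
Lemma general_position_lineP (S : {set LK}) :
  reflect {in S & &, forall e f g, meets (val e) (val f) -> meets (val f) (val g) ->
             meets (val e) (val g)}
          (general_position S).
Proof.
apply: (iffP (general_position_diameter2 _ line_complete_diameter2)) => tr e f g.
  move=> eS fS gS ef fg; have [-> | eg] := eqVneq e g.
    by rewrite meets_refl ?card_edge.
  have [eq_ef | nef] := eqVneq e f; first by rewrite eq_ef.
  have [<- // | nfg] := eqVneq f g.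
  by have /andP[] : sedge e g by apply: (tr e f g); rewrite //= /line_rel ?nef ?nfg.
move=> eS fS gS /andP[_ ef] /andP[_ fg] eg; rewrite /= /line_rel eg.
exact: tr ef fg.
Qed.

Lemma card_general_position (S : {set LK}) : general_position S ->
  #|S| <= n /\ (#|S| = n -> 3 %| n).
Proof.
move/general_position_lineP => tr.
have := @card_transitive_pairs _ (val @: S).
rewrite card_imset ?card_ord; last exact: val_inj.
apply=> [_ /imsetP[e _ ->]|]; first exact: card_edge.
by move=> _ _ _ /imsetP[e eS ->] /imsetP[f fS ->] /imsetP[g gS ->]; apply: tr.
Qed.

(** Lets lower-bound constructions be plain families of pairs, each being an edge of the complete
    graph. *)
Lemma gp_family (T : {set {set 'I_n}}) :
  {in T, forall e : {set 'I_n}, #|e| = 2} ->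
  {in T & &, forall e f g : {set 'I_n}, meets e f -> meets f g -> meets e g} ->
  #|T| <= gp LK.
Proof.
move=> T2 Tm; set S : {set LK} := [set e | val e \in T].
have gpS : general_position S.
  apply/general_position_lineP => e f g; rewrite !inE; exact: Tm.
apply: leq_trans (leq_bigmax_cond _ gpS).
suff -> : T = val @: S by apply: leq_imset_card.
apply/setP => e; apply/idP/imsetP => [eT | [f]]; last by rewrite inE => fT ->.
have eE : e \in edges (complete_graph n) by rewrite edges_completeE T2.
by exists (Sub e eE); rewrite ?inE SubK.
Qed.

Lemma gp_line_star (x : 'I_n) : n - 1 <= gp LK.
Proof.
pose star y : {set 'I_n} := [set x; y].
have in_star : {in [set~ x] &, injective star}.
  move=> y z; rewrite !inE => yx zx /setP/(_ y).
  by rewrite !inE eqxx orbT (negPf yx) => /esym/eqP.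
have := @gp_family (star @: [set~ x]).
rewrite card_in_imset // cardsC1 card_ord subn1; apply.
  by move=> _ /imsetP[y + ->]; rewrite !inE cards2 eq_sym => ->.
move=> _ _ _ /imsetP[y _ ->] _ /imsetP[z _ ->] _ _.
by rewrite meets_set2 set21.
Qed.

(* The cyclic shift of each block {3k, 3k+1, 3k+2}. *)
Definition turn (k : nat) := k %/ 3 * 3 + (k %% 3).+1 %% 3.

(** The pairs of [x] and [turn x] are the sides of disjoint triangles, one on each block. *)
Lemma gp_line_triangles : 3 %| n -> n <= gp LK.
Proof.
move=> n3; have turnP (x : 'I_n) : turn x < n.
  by rewrite /turn; have := ltn_ord x; lia.
pose side (x : 'I_n) := [set x; Ordinal (turnP x)].
(* Two pairs inside a block of three always meet; pairs in distinct blocks never do. *)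
have meets_side x y : meets (side x) (side y) = (x %/ 3 == y %/ 3).
  by rewrite meets_set2 !inE -!val_eqE /= /turn; lia.
(* Otherwise [turn] would swap [x] and [y], impossible for a 3-cycle. *)
have side_inj : injective side.
  move=> x y eq_xy; apply: val_inj => /=.
  move/setP: (eq_xy) => /(_ x); move/setP: eq_xy => /(_ y).
  by rewrite !inE !eqxx -!val_eqE /= /turn; lia.
have := @gp_family (side @: setT).
rewrite card_imset // cardsT card_ord; apply.
  move=> _ /imsetP[x _ ->]; rewrite cards2 -val_eqE /= /turn.
  by have -> : x != x %/ 3 * 3 + (x %% 3).+1 %% 3 :> nat by lia.
move=> _ _ _ /imsetP[x _ ->] /imsetP[y _ ->] /imsetP[z _ ->].
by rewrite !meets_side => /eqP->.
Qed.

End LineComplete.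

Theorem theorem4p4 (n : nat) (hn : 3 <= n) :
  gp (line_graph (complete_graph n)) = if 3 %| n then n else n - 1.
Proof.
apply/eqP; rewrite eqn_leq; apply/andP; split.
  apply/bigmax_leqP => S /card_general_position[le_n eq_n].
  case: ifP => [//|n3]; have: #|S| != n by apply: contraFneq n3 => /eq_n.
  by lia.
case: ifP => [|_]; first exact: gp_line_triangles.
(* The star is centred at vertex 0. *)
exact: gp_line_star (Ordinal (ltnW (ltnW hn))).
Qed.
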